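(* Let $X$ be a locally complete ordered set with a bottom element. A morphism $f\colon (A,\alpha)\to(B,\beta)$ of $\mathsf{Ord}//X$ is an effective descent morphism in $\mathsf{Ord}//X$ if and only if the following three conditions hold: (1) $f\colon A\to B$ is an effective descent morphism in $\mathsf{Ord}$; that is, for all $b_0\le b_1\le b_2$ in $B$ there exist $a_0\le a_1\le a_2$ in $A$ with $f(a_0)=b_0$, $f(a_1)=b_1$, $f(a_2)=b_2$. (2) For all $b_0\le b_1$ in $B$ and all $w\in X$ with $w\le\beta(b_0)$, $$w\;\cong\;\bigvee\{\,w\wedge\alpha(a_0)\;:\;a_0,a_1\in A,\ a_0\le a_1,\ f(a_0)=b_0,\ f(a_1)=b_1\,\},$$ the join being taken in $\downarrow\beta(b_0)$. (3) For every family $(\sigma(a))_{a\in A}$ of elements of $X$ with $\sigma(a)\le\alpha(a)$ for all $a\in A$ which satisfies $$\sigma(a')\wedge\alpha(a)\cong\alpha(a')\wedge\sigma(a)\quad\text{for all } b\in B \text{ and all } a,a'\in f^{-1}(b),$$ one has $$\alpha(a')\wedge\bigvee_{a\in f^{-1}(b)}\sigma(a)\;\cong\;\sigma(a')\quad\text{for all } b\in B \text{ and all } a'\in f^{-1}(b),$$ the join being taken in $\downarrow\beta(b)$.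
   Context: An ordered set is a set with a reflexive and transitive relation $\le$ (antisymmetry is not assumed); $x\cong y$ means $x\le y$ and $y\le x$. $\mathsf{Ord}$ is the category of ordered sets and monotone maps. For $x\in X$, $\downarrow x=\{y\in X: y\le x\}$. An ordered set is complete if every subset has a least upper bound (join), equivalently every subset has a greatest lower bound (meet), these being unique up to $\cong$. $X$ is locally complete if $\downarrow x$ is complete for every $x\in X$. Families $\sigma$ are arbitrary functions, not assumed monotone. Binary meets $\wedge$ are meets of pairs of elements having a common upper bound $x$, computed in $\downarrow x$ (the result does not depend on $x$ up to $\cong$). For an ordered set $X$, the lax comma category $\mathsf{Ord}//X$ has as objects pairs $(A,\alpha)$ with $A$ an ordered set and $\alpha\colon A\to X$ a monotone map; a morphism $f\colon(A,\alpha)\to(B,\beta)$ is a monotone map $f\colon A\to B$ with $\alpha(a)\le\beta(f(a))$ for all $a\in A$. When $X$ is locally complete, $\mathsf{Ord}//X$ has pullbacks. In a category $\mathsf{A}$ with pullbacks, a morphism $p\colon E\to B$ is an effective descent morphism (effective for descent) if the pullback functor $p^*\colon\mathsf{A}/B\to\mathsf{A}/E$ is monadic, i.e. the comparison functor $K^p$ from $\mathsf{A}/B$ to the Eilenberg–Moore category of the monad induced by the adjunction $p_!\dashv p^*$ is an equivalence. *)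

(* Defs.v *)
From mathcomp Require Import all_boot.
From mathcomp Require Import boolp classical_sets.

Set Implicit Arguments.
Unset Strict Implicit.
Unset Printing Implicit Defensive.

Local Obligation Tactic := idtac.

(** * Categories *)

(* Morphisms are compared with Leibniz equality; proof components of morphisms
   are irrelevant by [Prop_irrelevance]. *)
Record category := Category {
  obj :> Type;
  hom : obj -> obj -> Type;
  idm : forall x, hom x x;
  comp : forall x y z, hom y z -> hom x y -> hom x z;
  comp1m : forall x y (f : hom x y), comp (idm y) f = f;
  compm1 : forall x y (f : hom x y), comp f (idm x) = f;
  compA : forall w x y z (h : hom y z) (g : hom x y) (f : hom w x),
    comp h (comp g f) = comp (comp h g) f }.

Arguments idm {c} x.

Declare Scope cat_scope.
Delimit Scope cat_scope with cat.
Local Open Scope cat_scope.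

Notation "x ~> y" := (hom x y) (at level 70, no associativity) : cat_scope.
Notation "g ∘ f" := (comp g f) (at level 40, left associativity) : cat_scope.

Definition is_iso (C : category) (x y : C) (f : x ~> y) : Prop :=
  exists g : y ~> x, g ∘ f = idm x /\ f ∘ g = idm y.

Record functor (C D : category) := Functor {
  fobj :> C -> D;
  fmap : forall x y, (x ~> y) -> (fobj x ~> fobj y);
  fmap1 : forall x, fmap (idm x) = idm (fobj x);
  fmapM : forall x y z (g : y ~> z) (f : x ~> y),
    fmap (g ∘ f) = fmap g ∘ fmap f }.

Arguments fmap {C D} f0 {x y}.

Definition functor_id (C : category) : functor C C :=
  @Functor C C (fun x => x) (fun x y f => f)
    (fun=> erefl) (fun _ _ _ _ _ => erefl).

Program Definition functor_comp (C D E : category)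
    (G : functor D E) (F : functor C D) : functor C E :=
  @Functor C E (fun x => G (F x)) (fun x y f => fmap G (fmap F f)) _ _.
Next Obligation. by move=> C D E G F x /=; rewrite !fmap1. Qed.
Next Obligation. by move=> C D E G F x y z g f /=; rewrite !fmapM. Qed.

Definition natural (C D : category) (F G : functor C D)
    (t : forall x, F x ~> G x) : Prop :=
  forall x y (f : x ~> y), t y ∘ fmap F f = fmap G f ∘ t x.

Definition naturally_isomorphic (C D : category) (F G : functor C D) : Prop :=
  exists t : forall x, F x ~> G x, natural t /\ forall x, is_iso (t x).

Definition is_equivalence (C D : category) (F : functor C D) : Prop :=
  exists G : functor D C,
    naturally_isomorphic (functor_comp G F) (functor_id C) /\
    naturally_isomorphic (functor_comp F G) (functor_id D).

(** * Monads and Eilenberg-Moore categories *)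

Record monad (C : category) := Monad {
  mfun :> functor C C;
  eta : forall x, x ~> mfun x;
  mu : forall x, mfun (mfun x) ~> mfun x;
  eta_natural : natural (F := functor_id C) (G := mfun) eta;
  mu_natural : natural (F := functor_comp mfun mfun) (G := mfun) mu;
  mu_eta : forall x, mu x ∘ eta (mfun x) = idm (mfun x);
  mu_fmap_eta : forall x, mu x ∘ fmap mfun (eta x) = idm (mfun x);
  mu_mu : forall x, mu x ∘ mu (mfun x) = mu x ∘ fmap mfun (mu x) }.

Record algebra (C : category) (T : monad C) := Algebra {
  alg_obj : C;
  alg_act : T alg_obj ~> alg_obj;
  alg_unit : alg_act ∘ eta T alg_obj = idm alg_obj;
  alg_assoc : alg_act ∘ mu T alg_obj = alg_act ∘ fmap T alg_act }.

Section EilenbergMoore.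
Variables (C : category) (T : monad C).

Definition alg_hom (a b : algebra T) :=
  {h : alg_obj a ~> alg_obj b | h ∘ alg_act a = alg_act b ∘ fmap T h}.

Program Definition eilenberg_moore : category :=
  @Category (algebra T) alg_hom
    (fun a => exist _ (idm (alg_obj a)) _)
    (fun a b c g f => exist _ (sval g ∘ sval f) _) _ _ _.
Next Obligation. by move=> a /=; rewrite fmap1 comp1m compm1. Qed.
Next Obligation.
move=> a b c [g hg] [f hf] /=.
by rewrite -compA hf compA hg -compA fmapM.
Qed.
Next Obligation. by move=> a b [f hf]; apply: eq_exist; rewrite /= comp1m. Qed.
Next Obligation. by move=> a b [f hf]; apply: eq_exist; rewrite /= compm1. Qed.
Next Obligation.
by move=> a b c d [h hh] [g hg] [f hf]; apply: eq_exist; rewrite /= compA.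
Qed.

End EilenbergMoore.

(** * Adjunctions and monadicity *)

Record adjunction (C D : category) (F : functor C D) (G : functor D C) :=
  Adjunction {
  unit_ : forall x, x ~> G (F x);
  counit : forall y, F (G y) ~> y;
  unit_natural : natural (F := functor_id C) (G := functor_comp G F) unit_;
  counit_natural : natural (F := functor_comp F G) (G := functor_id D) counit;
  triangleF : forall x, counit (F x) ∘ fmap F (unit_ x) = idm (F x);
  triangleG : forall y, fmap G (counit y) ∘ unit_ (G y) = idm (G y) }.

Section Comparison.
Variables (C D : category) (F : functor C D) (G : functor D C).
Variable adj : adjunction F G.

Program Definition adj_monad : monad C :=
  @Monad C (functor_comp G F) (unit_ adj)
    (fun x => fmap G (counit adj (F x))) _ _ _ _ _.
Next Obligation. exact: unit_natural. Qed.
Next Obligation.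
move=> x y f /=; rewrite -!fmapM; congr (fmap G _).
exact: (counit_natural adj (fmap F f)).
Qed.
Next Obligation. by move=> x; exact: (triangleG adj (F x)). Qed.
Next Obligation. by move=> x /=; rewrite -fmapM triangleF fmap1. Qed.
Next Obligation.
move=> x /=; rewrite -!fmapM; congr (fmap G _).
by rewrite -(counit_natural adj (counit adj (F x))).
Qed.

Program Definition comparison : functor D (eilenberg_moore adj_monad) :=
  @Functor D (eilenberg_moore adj_monad)
    (fun y => @Algebra C adj_monad (G y) (fmap G (counit adj y)) _ _)
    (fun y z f => exist _ (fmap G f) _) _ _.
Next Obligation. by move=> y; exact: (triangleG adj y). Qed.
Next Obligation.
move=> y /=; rewrite -!fmapM; congr (fmap G _).
by rewrite -(counit_natural adj (counit adj y)).
Qed.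
Next Obligation.
move=> y z f /=; rewrite -!fmapM; congr (fmap G _).
by rewrite -(counit_natural adj f).
Qed.
Next Obligation. by move=> y; apply: eq_exist; rewrite fmap1. Qed.
Next Obligation. by move=> x y z g f; apply: eq_exist; rewrite fmapM. Qed.

Definition monadic : Prop := is_equivalence comparison.

End Comparison.

(** * Slices, pullbacks and effective descent *)

Record slice_obj (C : category) (B : C) := SliceObj {
  sdom : C;
  smap : sdom ~> B }.

Section Slice.
Variables (C : category) (B : C).

Definition slice_hom (x y : slice_obj B) :=
  {h : sdom x ~> sdom y | smap y ∘ h = smap x}.

Program Definition slice : category :=
  @Category (slice_obj B) slice_hom
    (fun x => exist _ (idm (sdom x)) _)
    (fun x y z g f => exist _ (sval g ∘ sval f) _) _ _ _.
Next Obligation. by move=> x /=; rewrite compm1. Qed.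
Next Obligation. by move=> x y z [g hg] [f hf] /=; rewrite compA hg. Qed.
Next Obligation. by move=> x y [f hf]; apply: eq_exist; rewrite /= comp1m. Qed.
Next Obligation. by move=> x y [f hf]; apply: eq_exist; rewrite /= compm1. Qed.
Next Obligation.
by move=> w x y z [h hh] [g hg] [f hf]; apply: eq_exist; rewrite /= compA.
Qed.

End Slice.

Record pullback (C : category) (E D B : C) (p : E ~> B) (q : D ~> B) :=
  Pullback {
  pb_obj : C;
  pb_fst : pb_obj ~> E;
  pb_snd : pb_obj ~> D;
  pb_square : p ∘ pb_fst = q ∘ pb_snd;
  pb_pair : forall (Z : C) (u : Z ~> E) (v : Z ~> D),
    p ∘ u = q ∘ v -> Z ~> pb_obj;
  pb_pair_fst : forall Z u v (h : p ∘ u = q ∘ v),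
    pb_fst ∘ @pb_pair Z u v h = u;
  pb_pair_snd : forall Z u v (h : p ∘ u = q ∘ v),
    pb_snd ∘ @pb_pair Z u v h = v;
  pb_ext : forall Z (k l : Z ~> pb_obj),
    pb_fst ∘ k = pb_fst ∘ l -> pb_snd ∘ k = pb_snd ∘ l -> k = l }.

(* A choice of pullbacks. Monadicity of the pullback functor does not depend
   on this choice. *)
Definition pullbacks (C : category) :=
  forall (E D B : C) (p : E ~> B) (q : D ~> B), pullback p q.

Section Descent.
Variables (C : category) (P : pullbacks C) (E B : C) (p : E ~> B).

Program Definition slice_push : functor (slice E) (slice B) :=
  @Functor (slice E) (slice B)
    (fun x => SliceObj (p ∘ smap x))
    (fun x y f => exist _ (sval f) _) _ _.
Next Obligation. by move=> x y [f hf] /=; rewrite -compA hf. Qed.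
Next Obligation. by move=> x; exact: eq_exist. Qed.
Next Obligation. by move=> x y z g f; exact: eq_exist. Qed.

Program Definition slice_pull : functor (slice B) (slice E) :=
  @Functor (slice B) (slice E)
    (fun x => SliceObj (pb_fst (P p (smap x))))
    (fun x y f => exist _
       (pb_pair (P p (smap y)) (u := pb_fst (P p (smap x)))
          (v := sval f ∘ pb_snd (P p (smap x))) _) _) _ _.
Next Obligation. by move=> x y [f hf] /=; rewrite compA hf pb_square. Qed.
Next Obligation. by move=> x y f /=; rewrite pb_pair_fst. Qed.
Next Obligation.
move=> x; apply: eq_exist; apply: pb_ext.
  by rewrite pb_pair_fst compm1.
by rewrite pb_pair_snd compm1 comp1m.
Qed.
Next Obligation.
move=> x y z g f; apply: eq_exist; apply: pb_ext.
  by rewrite /= compA !pb_pair_fst.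
by rewrite /= compA !pb_pair_snd -!compA pb_pair_snd.
Qed.

Program Definition slice_adj : adjunction slice_push slice_pull :=
  @Adjunction _ _ slice_push slice_pull
    (fun x => exist _
       (pb_pair (P p (p ∘ smap x)) (u := smap x) (v := idm (sdom x)) _) _)
    (fun y => exist _ (pb_snd (P p (smap y))) _) _ _ _ _.
Next Obligation. by move=> x /=; rewrite compm1. Qed.
Next Obligation. by move=> x; rewrite /= pb_pair_fst. Qed.
Next Obligation. by move=> y; rewrite /= pb_square. Qed.
Next Obligation.
move=> x y [f hf]; apply: eq_exist; apply: pb_ext.
  by rewrite /= !compA !pb_pair_fst.
by rewrite /= !compA !pb_pair_snd -compA pb_pair_snd comp1m compm1.
Qed.
Next Obligation. by move=> x y [f hf]; apply: eq_exist; rewrite /= pb_pair_snd. Qed.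
Next Obligation. by move=> x; apply: eq_exist; rewrite /= pb_pair_snd. Qed.
Next Obligation.
move=> y; apply: eq_exist; apply: pb_ext.
  by rewrite /= !compA !pb_pair_fst compm1.
by rewrite /= !compA !pb_pair_snd -compA pb_pair_snd !compm1.
Qed.

Definition effective_descent : Prop := monadic slice_adj.

End Descent.

(** * Ordered sets *)

Record ordset := OrdSet {
  carrier :> Type;
  ole : carrier -> carrier -> Prop;
  ole_refl : forall x, ole x x;
  ole_trans : forall y x z, ole x y -> ole y z -> ole x z }.

Notation "x ⊑ y" := (ole x y) (at level 70, no associativity) : cat_scope.

Definition oequiv (X : ordset) (x y : X) : Prop := x ⊑ y /\ y ⊑ x.

Notation "x ≅ y" := (oequiv x y) (at level 70, no associativity) : cat_scope.

Record monotone_map (A B : ordset) := MonotoneMap {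
  mono_fun :> A -> B;
  mono_le : forall x y, x ⊑ y -> mono_fun x ⊑ mono_fun y }.

Lemma monotone_map_eq (A B : ordset) (f g : monotone_map A B) :
  (forall a, f a = g a) -> f = g.
Proof.
case: f g => [f hf] [g hg] /= /funext fg.
by subst g; rewrite (Prop_irrelevance hf hg).
Qed.

Program Definition Ord : category :=
  @Category ordset monotone_map
    (fun A => @MonotoneMap A A (fun a => a) _)
    (fun A B C g f => @MonotoneMap A C (fun a => g (f a)) _) _ _ _.
Next Obligation. by []. Qed.
Next Obligation. by move=> A B C g f x y xy; do 2!apply: mono_le. Qed.
Next Obligation. by move=> A B f; exact: monotone_map_eq. Qed.
Next Obligation. by move=> A B f; exact: monotone_map_eq. Qed.
Next Obligation. by move=> A B C D h g f; exact: monotone_map_eq. Qed.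

Section OrdPullback.
Variables (E D B : ordset) (p : monotone_map E B) (q : monotone_map D B).

Program Definition ord_pb_obj : ordset :=
  @OrdSet {t : E * D | p t.1 = q t.2}
    (fun s t => (sval s).1 ⊑ (sval t).1 /\ (sval s).2 ⊑ (sval t).2) _ _.
Next Obligation. by move=> t; split; exact: ole_refl. Qed.
Next Obligation.
move=> t s r [st1 st2] [tr1 tr2].
by split; [exact: ole_trans st1 tr1 | exact: ole_trans st2 tr2].
Qed.

Program Definition ord_pb_fst : monotone_map ord_pb_obj E :=
  @MonotoneMap ord_pb_obj E (fun t => (sval t).1) _.
Next Obligation. by move=> s t []. Qed.

Program Definition ord_pb_snd : monotone_map ord_pb_obj D :=
  @MonotoneMap ord_pb_obj D (fun t => (sval t).2) _.
Next Obligation. by move=> s t []. Qed.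

Program Definition ord_pb_pair (Z : ordset) (u : monotone_map Z E)
    (v : monotone_map Z D) (h : forall z, p (u z) = q (v z)) :
    monotone_map Z ord_pb_obj :=
  @MonotoneMap Z ord_pb_obj (fun z => exist _ (u z, v z) (h z)) _.
Next Obligation. by move=> Z u v h x y xy; split; exact: mono_le. Qed.

Lemma ord_pb_ext (s t : ord_pb_obj) :
  ord_pb_fst s = ord_pb_fst t -> ord_pb_snd s = ord_pb_snd t -> s = t.
Proof.
by case: s t => [[e d] hs] [[e' d'] ht] /= ee dd; apply: eq_exist; rewrite ee dd.
Qed.

End OrdPullback.

Lemma Ord_hom_app (A B : Ord) (f g : A ~> B) (a : A) : f = g -> f a = g a.
Proof. by move=> ->. Qed.

Program Definition Ord_pullbacks : pullbacks Ord := fun E D B p q =>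
  @Pullback Ord E D B p q (ord_pb_obj p q) (ord_pb_fst p q) (ord_pb_snd p q) _
    (fun Z u v h => ord_pb_pair (fun z => Ord_hom_app z h)) _ _ _.
Next Obligation. by move=> E D B p q; apply: monotone_map_eq => -[]. Qed.
Next Obligation. by move=> *; exact: monotone_map_eq. Qed.
Next Obligation. by move=> *; exact: monotone_map_eq. Qed.
Next Obligation.
move=> E D B p q Z k l h1 h2; apply: monotone_map_eq => z.
by apply: ord_pb_ext; [exact: Ord_hom_app z h1 | exact: Ord_hom_app z h2].
Qed.

(** * Completeness *)

Section Completeness.
Local Open Scope classical_set_scope.

Definition is_join (X : ordset) (S : set X) (j : X) : Prop :=
  (forall s, S s -> s ⊑ j) /\ (forall u, (forall s, S s -> s ⊑ u) -> j ⊑ u).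

Definition is_meet (X : ordset) (S : set X) (m : X) : Prop :=
  (forall s, S s -> m ⊑ s) /\ (forall l, (forall s, S s -> l ⊑ s) -> l ⊑ m).

Definition complete (X : ordset) : Prop := forall S : set X, exists j, is_join S j.

Lemma complete_meet (X : ordset) :
  complete X -> forall S : set X, exists m, is_meet S m.
Proof.
move=> cX S; have [j [ubj lbj]] := cX [set l | forall s, S s -> l ⊑ s].
exists j; split=> [s Ss | l lS]; last exact: ubj.
by apply: lbj => l lS; exact: lS.
Qed.

Program Definition down (X : ordset) (x : X) : ordset :=
  @OrdSet {y : X | y ⊑ x} (fun y z => sval y ⊑ sval z) _ _.
Next Obligation. by move=> X x y; exact: ole_refl. Qed.
Next Obligation. by move=> X x z y w; exact: ole_trans. Qed.

Definition locally_complete (X : ordset) : Prop := forall x : X, complete (down x).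

Definition has_bottom (X : ordset) : Prop := exists b : X, forall x, b ⊑ x.

Variables (X : ordset) (hX : locally_complete X).

(* [join_in hX x S] is a join of [S] computed in [down x], for [S] contained in
   [down x] (elements of [S] not below [x] are ignored). *)
Definition join_in (x : X) (S : set X) : X :=
  sval (sval (cid (hX (x := x) [set y : down x | S (sval y)]))).

(* [meet_in hX x y z] is a meet of [y] and [z] computed in [down x], for [y] and
   [z] below [x]. *)
Definition meet_in (x y z : X) : X :=
  sval (sval (cid (complete_meet (hX (x := x))
    [set t : down x | sval t = y \/ sval t = z]))).

Lemma join_in_le (x : X) (S : set X) : join_in x S ⊑ x.
Proof. by rewrite /join_in; case: (sval (cid _)). Qed.

Lemma join_in_ub (x : X) (S : set X) (s : X) : S s -> s ⊑ x -> s ⊑ join_in x S.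
Proof.
rewrite /join_in; case: cid => j [ubj _] /= Ss sx.
exact: (ubj (exist _ s sx)).
Qed.

Lemma join_in_least (x : X) (S : set X) (u : X) :
  u ⊑ x -> (forall s, S s -> s ⊑ x -> s ⊑ u) -> join_in x S ⊑ u.
Proof.
rewrite /join_in; case: cid => j [_ lbj] /= ux hu.
by apply: (lbj (exist _ u ux)) => -[s sx] Ss; exact: hu.
Qed.

Lemma meet_in_le (x y z : X) : meet_in x y z ⊑ x.
Proof. by rewrite /meet_in; case: (sval (cid _)). Qed.

Lemma meet_in_lel (x y z : X) : y ⊑ x -> meet_in x y z ⊑ y.
Proof.
rewrite /meet_in; case: cid => m [lbm _] /= yx.
by apply: (lbm (exist _ y yx)); left.
Qed.

Lemma meet_in_ler (x y z : X) : z ⊑ x -> meet_in x y z ⊑ z.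
Proof.
rewrite /meet_in; case: cid => m [lbm _] /= zx.
by apply: (lbm (exist _ z zx)); right.
Qed.

Lemma meet_in_greatest (x y z l : X) :
  l ⊑ x -> l ⊑ y -> l ⊑ z -> l ⊑ meet_in x y z.
Proof.
rewrite /meet_in; case: cid => m [_ glm] /= lx ly lz.
by apply: (glm (exist _ l lx)) => -[s sx] /= [->|->].
Qed.

End Completeness.

(** * The lax comma category *)

Record lax_obj (X : ordset) := LaxObj {
  lax_ord : ordset;
  lax_map : monotone_map lax_ord X }.

Definition lax_hom (X : ordset) (A B : lax_obj X) :=
  {f : monotone_map (lax_ord A) (lax_ord B) |
    forall a, lax_map A a ⊑ lax_map B (f a)}.

Program Definition lax_comma (X : ordset) : category :=
  @Category (lax_obj X) (@lax_hom X)
    (fun A => exist _ (idm (lax_ord A : Ord)) _)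
    (fun A B C g f => exist _ (comp (c := Ord) (sval g) (sval f)) _) _ _ _.
Next Obligation. by move=> X A a; exact: ole_refl. Qed.
Next Obligation.
by move=> X A B C [g hg] [f hf] a /=; exact: ole_trans (hf a) (hg (f a)).
Qed.
Next Obligation. by move=> X A B [f hf]; apply: eq_exist; exact: (comp1m (c := Ord)). Qed.
Next Obligation. by move=> X A B [f hf]; apply: eq_exist; exact: (compm1 (c := Ord)). Qed.
Next Obligation. by move=> X A B C D h g f; apply: eq_exist; exact: (compA (c := Ord)). Qed.

Section LaxPullback.
Variables (X : ordset) (hX : locally_complete X).
Variables (E D B : lax_comma X) (p : E ~> B) (q : D ~> B).

Lemma lax_pb_le (t : ord_pb_obj (sval p) (sval q)) :
  lax_map E (sval t).1 ⊑ lax_map B (sval p (sval t).1) /\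
  lax_map D (sval t).2 ⊑ lax_map B (sval p (sval t).1).
Proof.
by case: t => [[e d] /= ped]; split; [exact: (svalP p) | rewrite ped; exact: (svalP q)].
Qed.

Program Definition lax_pb_obj : lax_comma X :=
  @LaxObj X (ord_pb_obj (sval p) (sval q))
    (MonotoneMap (mono_fun := fun t => meet_in hX
       (lax_map B (sval p (sval t).1))
       (lax_map E (sval t).1) (lax_map D (sval t).2)) _).
Next Obligation.
move=> s t [st1 st2].
have [sE sD] := lax_pb_le s.
apply: meet_in_greatest.
- by apply: ole_trans (meet_in_le _ _ _ _) _; do 2!apply: mono_le.
- by apply: ole_trans (meet_in_lel _ _ sE) _; exact: mono_le.
- by apply: ole_trans (meet_in_ler _ _ sD) _; exact: mono_le.
Qed.

Program Definition lax_pb_fst : lax_pb_obj ~> E :=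
  exist _ (ord_pb_fst (sval p) (sval q)) _.
Next Obligation. by move=> t; apply: meet_in_lel; have [] := lax_pb_le t. Qed.

Program Definition lax_pb_snd : lax_pb_obj ~> D :=
  exist _ (ord_pb_snd (sval p) (sval q)) _.
Next Obligation. by move=> t; apply: meet_in_ler; have [] := lax_pb_le t. Qed.

Lemma lax_hom_app (A A' : lax_comma X) (f g : A ~> A') (a : lax_ord A) :
  f = g -> sval f a = sval g a.
Proof. by move=> ->. Qed.

Program Definition lax_pb_pair (Z : lax_comma X) (u : Z ~> E) (v : Z ~> D)
    (h : p ∘ u = q ∘ v) : Z ~> lax_pb_obj :=
  exist _ (ord_pb_pair (p := sval p) (q := sval q) (u := sval u) (v := sval v)
             (fun z => lax_hom_app z h)) _.
Next Obligation.
move=> Z u v h z /=; apply: meet_in_greatest; last 2 first.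
- exact: (svalP u).
- exact: (svalP v).
by apply: ole_trans (svalP u z) _; exact: (svalP p).
Qed.

End LaxPullback.

Program Definition lax_pullbacks (X : ordset) (hX : locally_complete X) :
    pullbacks (lax_comma X) := fun E D B p q =>
  @Pullback (lax_comma X) E D B p q (lax_pb_obj hX p q)
    (lax_pb_fst hX p q) (lax_pb_snd hX p q) _ (@lax_pb_pair X hX E D B p q) _ _ _.
Next Obligation.
by move=> X hX E D B p q; apply: eq_exist; apply: monotone_map_eq => -[].
Qed.
Next Obligation.
by move=> X hX E D B p q Z [u hu] v h; apply: eq_exist; exact: monotone_map_eq.
Qed.
Next Obligation.
by move=> X hX E D B p q Z u [v hv] h; apply: eq_exist; exact: monotone_map_eq.
Qed.
Next Obligation.
move=> X hX E D B p q Z [k hk] [l hl] h1 h2; apply: eq_exist.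
apply: monotone_map_eq => z; apply: ord_pb_ext.
  exact: lax_hom_app z h1.
exact: lax_hom_app z h2.
Qed.

(* Main.v *)
(* Algebras for the monad induced by [p] are objects over [E] with an action of
   the fibres of [p]; the comparison is an equivalence when morphisms and
   objects with such actions descend along [p].

   In Ord, an action on [D] descends to the set of orbits, where one orbit lies
   below another if some representatives do; lifting chains of length three is
   what makes this relation transitive. Over [X], the orbit space gets the join
   of the values along each orbit: (3) says that pulling this back recovers the
   given values, and (2) that it is monotone.

   Conversely, apply essential surjectivity to the objects [{(a, i) | f a = b i}]
   for a family [b] of points of [B] ([effective_family]). An intransitive
   relation on three points gives (1), the values [w] and the join in (2) put
   on a two-point chain give (2), and a single point gives (3). The necessity of
   chain lifting in Ord is the case where [X] is a point. *)
Require Import Defs.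
From mathcomp Require Import all_boot.
From mathcomp Require Import boolp classical_sets.
(* Restores [compA] of categories over that of [ssrfun]. *)
Import Defs.

Set Implicit Arguments.
Unset Strict Implicit.
Unset Printing Implicit Defensive.

Local Open Scope classical_set_scope.
Local Open Scope cat_scope.
Local Obligation Tactic := idtac.

(** * Equivalences of categories *)

Section Equivalences.
Variables C D : category.

Definition faithful (F : functor C D) : Prop :=
  forall x y (h k : x ~> y), fmap F h = fmap F k -> h = k.

Definition full (F : functor C D) : Prop :=
  forall x y (g : F x ~> F y), exists h, fmap F h = g.

Definition essentially_surjective (F : functor C D) : Prop :=
  forall d, exists x (i : d ~> F x), is_iso i.

End Equivalences.

Lemma iso_monic (C : category) (x y z : C) (i : y ~> z) (h k : x ~> y) :
  is_iso i -> i ∘ h = i ∘ k -> h = k.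
Proof. by case=> j [ji _] e; rewrite -(comp1m h) -(comp1m k) -ji -!compA e. Qed.

Lemma iso_epic (C : category) (x y z : C) (i : x ~> y) (h k : y ~> z) :
  is_iso i -> h ∘ i = k ∘ i -> h = k.
Proof. by case=> j [_ ij] e; rewrite -(compm1 h) -(compm1 k) -ij !compA e. Qed.

(** Naturality recovers [h] from [fmap F h] by conjugation with the components of [t]. *)
Lemma retract_faithful (C D : category) (F : functor C D) (G : functor D C) :
  naturally_isomorphic (functor_comp G F) (functor_id C) -> faithful F.
Proof.
case=> t [nt it] x y h k e; apply: (iso_epic (it x)).
by rewrite -[LHS]nt -[RHS]nt /= e.
Qed.

(** A preimage of [g] is [fmap G g] conjugated by the isomorphism from [GF] to the identity. The
    equation is checked after applying [G], which is faithful by the other isomorphism. *)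
Lemma equivalence_full (C D : category) (F : functor C D) :
  is_equivalence F -> full F.
Proof.
case=> G [[t [nt it]] /retract_faithful fG] x y g.
have [j [ji _]] := it x.
exists (t y ∘ fmap G g ∘ j); apply: fG; apply: (iso_monic (it y)).
by rewrite [LHS]nt /= -compA ji compm1.
Qed.

Lemma full_faithful_equivalence (C D : category) (F : functor C D) :
  faithful F -> full F -> essentially_surjective F -> is_equivalence F.
Proof.
move=> faF fuF esF.
pose g d := sval (cid (esF d)).
have exi d : {i : d ~> F (g d) | is_iso i} by apply: cid; exact: svalP (cid (esF d)).
pose i d := sval (exi d).
have exj d : {j : F (g d) ~> d | j ∘ i d = idm d /\ i d ∘ j = idm (F (g d))}.
  by apply: cid; exact: svalP (exi d).
pose j d := sval (exj d).
have ji d : j d ∘ i d = idm d by have [] := svalP (exj d).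
have ij d : i d ∘ j d = idm (F (g d)) by have [] := svalP (exj d).
pose pre x y (u : F x ~> F y) := sval (cid (fuF x y u)).
have preE x y (u : F x ~> F y) : fmap F (pre x y u) = u := svalP (cid (fuF x y u)).
have G1 d : pre _ _ (i d ∘ idm d ∘ j d) = idm (g d).
  by apply: faF; rewrite preE fmap1 compm1.
have GM x y z (v : y ~> z) (u : x ~> y) :
    pre _ _ (i z ∘ (v ∘ u) ∘ j x) =
    pre _ _ (i z ∘ v ∘ j y) ∘ pre _ _ (i y ∘ u ∘ j x).
  apply: faF; rewrite fmapM !preE -!compA; congr (_ ∘ _); congr (_ ∘ _).
  by rewrite !compA ji comp1m.
exists (Functor G1 GM); split.
  exists (fun x => pre (g (F x)) x (j (F x))).
  split; first move=> x y h /=.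
    by apply: faF; rewrite !fmapM !preE !compA ji comp1m.
  move=> x; exists (pre x (g (F x)) (i (F x))).
  by split; apply: faF; rewrite fmapM !preE fmap1 ?ij ?ji.
exists j; split; last by move=> x; exists (i x); exact: conj (ij x) (ji x).
by move=> x y h; rewrite /= preE !compA ji comp1m.
Qed.

Lemma algebra_iso (C : category) (T : monad C) (a b : eilenberg_moore T)
    (h : a ~> b) : is_iso (sval h) -> is_iso h.
Proof.
case=> j [jh hj].
have ja : j ∘ alg_act b = alg_act a ∘ fmap T j.
  rewrite -[LHS]compm1 -fmap1 -hj fmapM -compA.
  by rewrite [alg_act b ∘ _]compA -(svalP h) !compA jh comp1m.
by exists (exist _ j ja); split; apply: eq_exist.
Qed.

(** * Descent in terms of generalized elements *)

Section Descent.
Variables (C : category) (P : pullbacks C) (E B : C) (p : E ~> B).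

Definition descent_faithful : Prop :=
  forall (D D' : C) (q : D ~> B) (q' : D' ~> B) (h k : D ~> D'),
    q' ∘ h = q -> q' ∘ k = q ->
    h ∘ pb_snd (P p q) = k ∘ pb_snd (P p q) -> h = k.

(** A morphism of algebras between pullbacks is determined by its second component [k]. The action
    changes only the coordinate in [E], so equivariance says that [k] does not depend on that
    coordinate. *)
Definition descent_full : Prop :=
  forall (D D' : C) (q : D ~> B) (q' : D' ~> B) (k : pb_obj (P p q) ~> D'),
    q' ∘ k = p ∘ pb_fst (P p q) ->
    (forall Z (u v : Z ~> pb_obj (P p q)),
      pb_snd (P p q) ∘ u = pb_snd (P p q) ∘ v -> k ∘ u = k ∘ v) ->
    exists2 h : D ~> D', q' ∘ h = q & h ∘ pb_snd (P p q) = k.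

(* For the action [(a, x) |-> a x] on pairs in the same fibre: [c (a x) = a],
   [c x x = x] and [a' (a x) = a' x]; here [s = (a, x)], [r = (a', a x)] and
   [t = (a', x)]. *)
Definition descent_datum (D : C) (c : D ~> E)
    (act : pb_obj (P p (p ∘ c)) ~> D) : Prop :=
  [/\ c ∘ act = pb_fst _,
      forall Z (t : Z ~> pb_obj (P p (p ∘ c))),
        pb_fst _ ∘ t = c ∘ (pb_snd _ ∘ t) -> act ∘ t = pb_snd _ ∘ t
    & forall Z (r s t : Z ~> pb_obj (P p (p ∘ c))),
        pb_snd _ ∘ r = act ∘ s -> pb_snd _ ∘ t = pb_snd _ ∘ s ->
        pb_fst _ ∘ t = pb_fst _ ∘ r -> act ∘ r = act ∘ t].

Definition descent_effective : Prop :=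
  forall (D : C) (c : D ~> E) (act : pb_obj (P p (p ∘ c)) ~> D),
    descent_datum act ->
    exists (D' : C) (q : D' ~> B) (i : D ~> pb_obj (P p q)),
      [/\ is_iso i, pb_fst _ ∘ i = c
        & pb_snd _ ∘ (i ∘ act) = pb_snd _ ∘ (i ∘ pb_snd _)].

Lemma descent_faithfulP :
  faithful (comparison (slice_adj P p)) <-> descent_faithful.
Proof.
split=> [fK D D' q q' h k qh qk hk|fP x y [h hh] [k kk] e].
  have := fK (SliceObj q) (SliceObj q') (exist _ h qh) (exist _ k qk).
  move=> /(_ _) H; apply: (congr1 sval (H _)).
  apply: eq_exist; apply: eq_exist; apply: pb_ext; rewrite ?pb_pair_fst //.
  by rewrite !pb_pair_snd.
apply: eq_exist; apply: (fP _ _ (smap x) (smap y)) => //.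
have := congr1 (fun u => pb_snd _ ∘ sval (sval u)) e.
by rewrite /= !pb_pair_snd.
Qed.

Lemma descent_fullP : full (comparison (slice_adj P p)) <-> descent_full.
Proof.
split=> [fK D D' q q' k qk kuv|fP x y [[g gf] ga]].
  pose g := pb_pair (P p q') (esym qk).
  have gf : pb_fst _ ∘ g = pb_fst (P p q) by exact: pb_pair_fst.
  have gs : pb_snd _ ∘ g = k by exact: pb_pair_snd.
  pose x : slice B := SliceObj q; pose y : slice B := SliceObj q'.
  pose g' : slice_pull P p x ~> slice_pull P p y := exist _ g gf.
  have ga : g' ∘ fmap (slice_pull P p) (counit (slice_adj P p) x) =
      fmap (slice_pull P p) (counit (slice_adj P p) y) ∘
      fmap (slice_pull P p) (fmap (slice_push p) g').
    apply: eq_exist; apply: pb_ext; rewrite /= !compA.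
      by rewrite gf !pb_pair_fst.
    rewrite gs !pb_pair_snd -compA pb_pair_snd compA gs.
    by apply: kuv; rewrite pb_pair_snd.
  have [[h qh] he] := fK x y (exist _ g' ga).
  exists h => //.
  have := congr1 (fun u => pb_snd _ ∘ sval (sval u)) he.
  by rewrite /= pb_pair_snd gs.
have ga' := congr1 (fun u => pb_snd _ ∘ sval u) ga.
rewrite /= !compA !pb_pair_snd -!compA pb_pair_snd in ga'.
rewrite /= in g gf ga ga' *.
have kuv Z (u v : Z ~> pb_obj (P p (smap x))) :
    pb_snd _ ∘ u = pb_snd _ ∘ v -> pb_snd _ ∘ g ∘ u = pb_snd _ ∘ g ∘ v.
  (* Equivariance of [g] is evaluated at the point [(pb_fst ∘ u, v)] of the iterated pullback: there
     the action replaces the first coordinate of [v] and yields [u]. *)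
  move=> uv.
  have wE : p ∘ (pb_fst _ ∘ u) = p ∘ pb_fst _ ∘ v.
    by rewrite compA !pb_square -!compA uv.
  have := congr1 (fun w => w ∘ pb_pair (P p (p ∘ pb_fst (P p (smap x)))) wE) ga'.
  rewrite -!compA pb_pair_snd => <-; congr (_ ∘ (_ ∘ _)).
  apply: pb_ext; rewrite compA ?pb_pair_fst ?pb_pair_fst //.
  by rewrite pb_pair_snd -compA pb_pair_snd.
have [||h qh hs] := fP _ _ (smap x) (smap y) (pb_snd _ ∘ g).
- by rewrite compA -pb_square -compA gf.
- exact: kuv.
exists (exist _ h qh); apply: eq_exist; apply: eq_exist; apply: pb_ext => /=.
  by rewrite pb_pair_fst gf.
by rewrite pb_pair_snd hs.
Qed.

Lemma descent_effectiveP :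
  essentially_surjective (comparison (slice_adj P p)) <-> descent_effective.
Proof.
split=> [eK D c act [ca cu cm]|eP [[D c] a cu0 cm0]].
  pose x : slice E := SliceObj c.
  pose act' : slice_pull P p (slice_push p x) ~> x := exist _ act ca.
  have au : act' ∘ unit_ (slice_adj P p) x = idm x.
    apply: eq_exist; rewrite /= cu; first by rewrite pb_pair_snd.
    by rewrite pb_pair_fst pb_pair_snd compm1.
  have am : act' ∘ mu (adj_monad (slice_adj P p)) x =
      act' ∘ fmap (adj_monad (slice_adj P p)) act'.
    apply: eq_exist; rewrite /=; apply/esym.
    by apply: (cm _ _ (pb_snd _)); rewrite ?pb_pair_snd ?pb_pair_fst.
  have [[D' q] [[[i ic] ia] ii]] :=
    eK (@Algebra _ (adj_monad (slice_adj P p)) x act' au am).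
  rewrite /= in i ic ia ii *.
  exists D', q, i; split=> //.
    case: ii => -[[j jc] ja] /= [e1 e2]; exists j.
    by split; [have := congr1 (fun u => sval (sval u)) e1
              |have := congr1 (fun u => sval (sval u)) e2].
  have := congr1 (fun u => pb_snd _ ∘ sval u) ia.
  by rewrite /= [in RHS]compA pb_pair_snd -compA pb_pair_snd.
have cu := congr1 sval cu0; have cm := congr1 sval cm0.
pose act := sval a; have ca : c ∘ act = pb_fst _ := svalP a.
rewrite /= -/act in cu cm *.
have [|D' [q [i [[j [ji ij]] ic ia]]]] := eP D c act.
  split=> // Z.
    move=> t tE; have := congr1 (fun u => u ∘ (pb_snd _ ∘ t)) cu.
    rewrite /= comp1m -compA => e; rewrite -[RHS]e; congr (_ ∘ _).
    apply: pb_ext; rewrite !compA.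
      by rewrite pb_pair_fst tE compA.
    by rewrite pb_pair_snd comp1m.
  move=> r s t rs ts tr.
  (* Associativity is evaluated at the point [(pb_fst ∘ r, s)] of the iterated pullback, which the
     multiplication sends to [t] and the lifted action to [r]. *)
  have wE : p ∘ (pb_fst _ ∘ r) = p ∘ pb_fst (P p (p ∘ c)) ∘ s.
    by rewrite compA [in LHS]pb_square -compA rs -ca !compA.
  have := congr1 (fun u => u ∘ pb_pair (P p (p ∘ pb_fst (P p (p ∘ c)))) wE) cm.
  rewrite /= -!compA => e.
  apply: etrans (etrans _ (esym e)) _; congr (_ ∘ _); apply: pb_ext.
  - by rewrite compA !pb_pair_fst.
  - by rewrite compA pb_pair_snd -compA pb_pair_snd.
  - by rewrite compA !pb_pair_fst.
  - by rewrite compA pb_pair_snd -compA pb_pair_snd.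
pose K := Algebra cu0 cm0.
pose i' : (SliceObj c : slice E) ~> slice_pull P p (SliceObj q) := exist _ i ic.
have ia' : i' ∘ a = fmap (slice_pull P p) (counit (slice_adj P p) (SliceObj q)) ∘
    fmap (adj_monad (slice_adj P p)) i'.
  apply: eq_exist; apply: pb_ext; rewrite /= !compA -/act.
    by rewrite ic ca !pb_pair_fst.
  by rewrite -compA ia !pb_pair_snd -!compA pb_pair_snd.
exists (SliceObj q), (exist _ i' ia'); apply: algebra_iso.
have jc : c ∘ j = pb_fst (P p q) by rewrite -ic -compA ij compm1.
by exists (exist _ j jc); split; apply: eq_exist.
Qed.

Lemma effective_descentP :
  effective_descent P p <->
  [/\ descent_faithful, descent_full & descent_effective].
Proof.
split=> [eK|[/descent_faithfulP faK /descent_fullP fuK /descent_effectiveP esK]].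
  split; [apply/descent_faithfulP|apply/descent_fullP|apply/descent_effectiveP].
  - by case: eK => G [/retract_faithful].
  - exact: equivalence_full.
  - case: eK => G [_ [u [_ iu]]] d; have [v [vu uv]] := iu d.
    by exists (G d), v, (u d).
exact: full_faithful_equivalence.
Qed.

End Descent.

(** * Effective descent in Ord *)

Definition point : ordset :=
  @OrdSet unit (fun _ _ => True) (fun _ => I) (fun _ _ _ _ _ => I).

Definition const_map (Z D : ordset) (x : D) : monotone_map Z D :=
  MonotoneMap (fun _ _ _ => ole_refl x).

Lemma Ord_isoP (D D' : Ord) (i : D ~> D') : is_iso i ->
  exists2 j : monotone_map D' D, cancel i j & cancel j i.
Proof.
by case=> j [ji ij]; exists j => x; [exact: Ord_hom_app ji|exact: Ord_hom_app ij].
Qed.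

(** * Fibre actions on ordered sets, element by element *)

Section ActionsInOrd.
Variables (A B D : Ord) (f : A ~> B) (c : D ~> A).
Variable act : pb_obj (Ord_pullbacks f (f ∘ c)) ~> D.

Definition pointwise_datum : Prop :=
  [/\ forall t, c (act t) = (sval t).1,
      forall t, (sval t).1 = c (sval t).2 -> act t = (sval t).2
    & forall r s t, (sval r).2 = act s -> (sval t).2 = (sval s).2 ->
        (sval t).1 = (sval r).1 -> act r = act t].

Lemma descent_datum_pointwise : descent_datum act -> pointwise_datum.
Proof.
pose pt (t : ord_pb_obj f (f ∘ c)) :
  (point : Ord) ~> pb_obj (Ord_pullbacks f (f ∘ c)) := const_map point t.
case=> ca cu cm; split.
- by move=> t; exact: Ord_hom_app ca.
- move=> t e; have H : act ∘ pt t = pb_snd _ ∘ pt t.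
    by apply: cu; exact: monotone_map_eq.
  exact: (Ord_hom_app (A := point) tt H).
- move=> r s t rs ts tr.
  have H : act ∘ pt r = act ∘ pt t.
    by apply: (cm _ _ (pt s)); exact: monotone_map_eq.
  exact: (Ord_hom_app (A := point) tt H).
Qed.

(* Extends [act] by the junk value [x] to pairs outside the pullback. *)
Definition total_act (a : A) (x : D) : D :=
  if pselect (f a = f (c x)) is left e then act (exist _ (a, x) e) else x.

Hypothesis act_datum : pointwise_datum.

Lemma total_actE a x (e : f a = f (c x)) :
  total_act a x = act (exist _ (a, x) e).
Proof.
rewrite /total_act; case: pselect => // e'.
by congr (act _); exact: eq_exist.
Qed.

Lemma total_act_fst a x : f a = f (c x) -> c (total_act a x) = a.
Proof. by case: act_datum => ca _ _ e; rewrite (total_actE e) ca. Qed.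

Lemma total_act_unit x : total_act (c x) x = x.
Proof. by case: act_datum => _ cu _; rewrite (total_actE erefl) cu. Qed.

Lemma total_act_act a a' x : f a = f (c x) -> f a' = f (c x) ->
  total_act a' (total_act a x) = total_act a' x.
Proof.
case: act_datum => _ _ cm e e'.
have e1 : f a' = f (c (total_act a x)) by rewrite total_act_fst ?e.
rewrite (total_actE e1) (total_actE e').
by apply: (cm _ (exist _ (a, x) e)) => //=; rewrite total_actE.
Qed.

Lemma total_act_le a a' x x' : f a = f (c x) -> f a' = f (c x') ->
  a ⊑ a' -> x ⊑ x' -> total_act a x ⊑ total_act a' x'.
Proof.
by move=> e e' aa xx; rewrite (total_actE e) (total_actE e'); exact: mono_le.
Qed.

End ActionsInOrd.

(** * Descent from chain lifting in [Ord] *)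

Section ChainLifting.
Variables (A B : Ord) (f : A ~> B).

Definition lifts_chains : Prop :=
  forall b0 b1 b2 : (B : ordset), b0 ⊑ b1 -> b1 ⊑ b2 ->
    exists a0 a1 a2 : (A : ordset),
      [/\ a0 ⊑ a1, a1 ⊑ a2, f a0 = b0, f a1 = b1 & f a2 = b2].

Hypothesis chains : lifts_chains.

Lemma lifts_pairs (b0 b1 : B : ordset) : b0 ⊑ b1 ->
  exists a0 a1 : (A : ordset), [/\ a0 ⊑ a1, f a0 = b0 & f a1 = b1].
Proof.
move=> b01; have [a0 [a1 [_ [a01 _ ? ? _]]]] := chains b01 (ole_refl b1).
by exists a0, a1.
Qed.

Lemma lifts_points (b : B) : exists a, f a = b.
Proof. by have [a [_ [_ ? _]]] := lifts_pairs (ole_refl b); exists a. Qed.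

Lemma chains_descent_faithful : descent_faithful Ord_pullbacks f.
Proof.
move=> D D' q q' h k _ _ e; apply: monotone_map_eq => x.
have [a ax] := lifts_points (q x).
exact: (Ord_hom_app (A := ord_pb_obj f q) (exist _ (a, x) ax) e).
Qed.

(** Lifting points defines the map through a choice in each fibre, of which [k] is independent;
    lifting pairs makes it monotone. *)
Lemma chains_descent_full : descent_full Ord_pullbacks f.
Proof.
move=> D D' q q' k qk kuv.
have kE t t' : (sval t).2 = (sval t').2 -> k t = k t'.
  pose pt (t : ord_pb_obj f q) :
    (point : Ord) ~> pb_obj (Ord_pullbacks f q) := const_map point t.
  move=> e; have H : k ∘ pt t = k ∘ pt t'.
    by apply: kuv; exact: monotone_map_eq.
  exact: (Ord_hom_app (A := point) tt H).
pose s x := sval (cid (lifts_points (q x))).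
have fs x : f (s x) = q x := svalP (cid (lifts_points (q x))).
pose h0 x := k (exist _ (s x, x) (fs x)).
have h0_le x y : x ⊑ y -> h0 x ⊑ h0 y.
  move=> xy; have [a [a' [aa ax ay]]] := lifts_pairs (mono_le q xy).
  rewrite /h0 (kE _ (exist _ (a, x) ax)) //.
  rewrite [k (exist _ (s y, y) _)](kE _ (exist _ (a', y) ay)) //.
  exact: mono_le.
exists (MonotoneMap h0_le); apply: monotone_map_eq; [move=> x|move=> t].
  rewrite -fs.
  exact: (Ord_hom_app (A := ord_pb_obj f q) (exist _ (s x, x) (fs x)) qk).
exact: kE.
Qed.

(** * The orbit space of an action *)

Section Quotient.
Variables (D : Ord) (c : D ~> A) (act : pb_obj (Ord_pullbacks f (f ∘ c)) ~> D).
Hypothesis act_datum : pointwise_datum act.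

Local Notation tact := (total_act act).

Definition section (b : B) : A := sval (cid (lifts_points b)).

Lemma sectionK b : f (section b) = b.
Proof. exact: svalP (cid (lifts_points b)). Qed.

Definition orbit_le (x y : D) : Prop :=
  exists a a', [/\ f a = f (c x), f a' = f (c y) & tact a x ⊑ tact a' y].

(** Acting by [a ⊑ a'] on the related representatives moves their inequality to the prescribed base
    points, since each action overrides the previous one. *)
Lemma orbit_le_act x y a a' : orbit_le x y -> f a = f (c x) -> f a' = f (c y) ->
  a ⊑ a' -> tact a x ⊑ tact a' y.
Proof.
case=> a1 [a1' [e1 e1' xy]] e e' aa.
rewrite -(total_act_act act_datum e1 e) -(total_act_act act_datum e1' e').
by apply: total_act_le => //; rewrite total_act_fst // ?e1 ?e1'.
Qed.

Lemma orbit_le_base x y : orbit_le x y -> f (c x) ⊑ f (c y).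
Proof.
case=> a [a' [e e' xy]]; rewrite -e -e'; apply: mono_le.
by rewrite -(total_act_fst act_datum e) -(total_act_fst act_datum e'); exact: mono_le.
Qed.

(* Each orbit of the action is represented by its unique element lying over
   the chosen point of the fibre. *)
Program Definition orbits : ordset :=
  @OrdSet {x : D | c x = section (f (c x))}
    (fun x y => orbit_le (sval x) (sval y)) _ _.
Next Obligation.
by move=> x; exists (c (sval x)), (c (sval x)); split=> //; exact: ole_refl.
Qed.
Next Obligation.
move=> y x z xy yz.
(* Lifting the chain as a whole yields one middle point [a1], so the two relations, moved to
   [a0 ⊑ a1] and [a1 ⊑ a2], meet in the same element. *)
have [a0 [a1 [a2 [a01 a12 e0 e1 e2]]]] :=
  chains (orbit_le_base xy) (orbit_le_base yz).
exists a0, a2; split=> //; apply: ole_trans (orbit_le_act xy e0 e1 a01) _.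
exact: orbit_le_act.
Qed.

Lemma orbits_map_le (x y : orbits) :
  x ⊑ y -> f (c (sval x)) ⊑ f (c (sval y)).
Proof. exact: orbit_le_base. Qed.

Definition orbits_map : monotone_map orbits B := MonotoneMap orbits_map_le.

Lemma repr_subproof x (r := tact (section (f (c x))) x) :
  c r = section (f (c r)).
Proof. by rewrite /r (total_act_fst act_datum) ?sectionK. Qed.

Definition repr (x : D) : orbits := exist _ _ (repr_subproof x).

Lemma orbits_map_repr x : f (c x) = orbits_map (repr x).
Proof. by rewrite /= (total_act_fst act_datum) ?sectionK. Qed.

Lemma total_act_repr a x : f a = f (c x) -> tact a (sval (repr x)) = tact a x.
Proof. by move=> e; apply: total_act_act => //; exact: sectionK. Qed.

Lemma repr_act a x : f a = f (c x) -> repr (tact a x) = repr x.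
Proof.
move=> e; apply: eq_exist; rewrite (total_act_fst act_datum) // e.
by apply: total_act_act => //; exact: sectionK.
Qed.

Lemma repr_orbit (x : orbits) : repr (sval x) = x.
Proof.
case: x => x hx; apply: eq_exist => /=.
by rewrite -hx; exact: total_act_unit.
Qed.

Program Definition to_pullback : monotone_map D (ord_pb_obj f orbits_map) :=
  MonotoneMap (mono_fun := fun x => exist _ (c x, repr x) (orbits_map_repr x)) _.
Next Obligation.
move=> x y xy; split; first exact: mono_le.
exists (c x), (c y); split; try exact: orbits_map_repr.
by rewrite /= !(total_act_repr (erefl (f (c _)))) // !(total_act_unit act_datum).
Qed.

Program Definition from_pullback : monotone_map (ord_pb_obj f orbits_map) D :=
  MonotoneMap (mono_fun := fun t => tact (sval t).1 (sval (sval t).2)) _.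
Next Obligation.
by move=> [[a x] e] [[a' x'] e'] [/= aa xx]; exact: orbit_le_act.
Qed.

Lemma to_pullback_iso : is_iso (to_pullback : D ~> pb_obj (Ord_pullbacks f orbits_map)).
Proof.
exists (from_pullback : pb_obj (Ord_pullbacks f orbits_map) ~> D); split.
  apply: monotone_map_eq => x /=.
  by rewrite total_act_repr // (total_act_unit act_datum).
apply: monotone_map_eq => -[[a x] /= e]; apply: eq_exist.
by rewrite (total_act_fst act_datum) // repr_act // repr_orbit.
Qed.

End Quotient.

Lemma chains_descent_effective : descent_effective Ord_pullbacks f.
Proof.
move=> D c act /descent_datum_pointwise act_datum.
exists (orbits act_datum), (orbits_map act_datum), (to_pullback act_datum).
split; [exact: to_pullback_iso|exact: monotone_map_eq|].
by apply: monotone_map_eq => -[[a x] e] /=; rewrite -(total_actE act e) repr_act.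
Qed.

Lemma chains_effective_descent : effective_descent Ord_pullbacks f.
Proof.
apply/effective_descentP; split; [exact: chains_descent_faithful
  |exact: chains_descent_full|exact: chains_descent_effective].
Qed.

End ChainLifting.

(** * Sufficiency in the lax comma category *)

Lemma lax_hom_eq (X : ordset) (D D' : lax_comma X) (u v : D ~> D') :
  (forall x, sval u x = sval v x) -> u = v.
Proof.
by case: u v => [u hu] [v hv] uv; apply: eq_exist; exact: monotone_map_eq.
Qed.

Lemma lax_hom_fun (X : ordset) (D D' : lax_comma X) (u v : D ~> D') :
  u = v -> (sval u : (lax_ord D : Ord) ~> (lax_ord D' : Ord)) = sval v.
Proof. by move=> ->. Qed.

Section MeetIn.
Variables (X : ordset) (hX : locally_complete X).

Lemma meet_in_mono (x y z y' z' : X) : y ⊑ x -> z ⊑ x -> y ⊑ y' -> z ⊑ z' ->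
  meet_in hX x y z ⊑ meet_in hX x y' z'.
Proof.
move=> yx zx yy zz; apply: meet_in_greatest; first exact: meet_in_le.
  exact: ole_trans (meet_in_lel hX z yx) yy.
exact: ole_trans (meet_in_ler hX y zx) zz.
Qed.

Lemma meet_in_swap (x y z : X) : y ⊑ x -> z ⊑ x ->
  meet_in hX x y z ⊑ meet_in hX x z y.
Proof.
move=> yx zx; apply: meet_in_greatest; first exact: meet_in_le.
  exact: meet_in_ler.
exact: meet_in_lel.
Qed.

End MeetIn.

Section LaxDescent.
Variables (X : ordset) (hX : locally_complete X).
Variables (A B : lax_comma X) (f : A ~> B).

Local Notation α := (lax_map A).
Local Notation β := (lax_map B).
Local Notation f0 := (sval f : (lax_ord A : Ord) ~> (lax_ord B : Ord)).
Local Notation meet b := (meet_in hX (β b)).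
Local Notation join b := (join_in hX (β b)).

Definition pair_covering : Prop :=
  forall b0 b1 : lax_ord B, b0 ⊑ b1 -> forall w : X, w ⊑ β b0 ->
    w ≅ join b0 [set v | exists a0 a1 : lax_ord A,
      [/\ a0 ⊑ a1, f0 a0 = b0, f0 a1 = b1 & v = meet b0 w (α a0)]].

Definition families_glue : Prop :=
  forall σ : lax_ord A -> X, (forall a, σ a ⊑ α a) ->
    (forall (b : lax_ord B) (a a' : lax_ord A), f0 a = b -> f0 a' = b ->
      meet b (σ a') (α a) ≅ meet b (α a') (σ a)) ->
    forall (b : lax_ord B) (a' : lax_ord A), f0 a' = b ->
      meet b (α a') (join b [set v | exists a, f0 a = b /\ v = σ a]) ≅ σ a'.

Lemma lax_map_fibre (a : lax_ord A) (b : lax_ord B) : f0 a = b -> α a ⊑ β b.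
Proof. by move=> <-; exact: (svalP f). Qed.

Section Bottom.
Variables (bot : X) (bot_le : forall x, bot ⊑ x).

Definition lax_bot (Z : ordset) : lax_comma X := LaxObj (const_map Z bot).

(* The bottom structure makes every monotone map out of a test object lax, so
   conditions on generalized elements transfer between Ord and [lax_comma X]. *)
Definition to_lax_pb (D D' E : lax_comma X) (p : D ~> E) (q : D' ~> E) (Z : Ord)
    (u : monotone_map Z (ord_pb_obj (sval p) (sval q))) :
    lax_bot Z ~> pb_obj (lax_pullbacks hX p q) :=
  exist _ u (fun=> bot_le _).

Section Sufficiency.
Hypothesis f0_effective : effective_descent Ord_pullbacks f0.
Hypothesis covering : pair_covering.
Hypothesis glue : families_glue.

(** The underlying ordered set of a lax pullback is the pullback in [Ord], and lax morphisms with
    equal underlying maps are equal. *)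
Lemma lax_descent_faithful : descent_faithful (lax_pullbacks hX) f.
Proof.
have [faF _ _] := (effective_descentP Ord_pullbacks f0).1 f0_effective.
move=> D D' q q' h k qh qk e; apply: lax_hom_eq => ?; apply: Ord_hom_app.
apply: (faF _ _ (sval q) (sval q')).
- exact: lax_hom_fun qh.
- exact: lax_hom_fun qk.
- exact: lax_hom_fun e.
Qed.

Lemma lax_descent_full : descent_full (lax_pullbacks hX) f.
Proof.
have [_ fuF _] := (effective_descentP Ord_pullbacks f0).1 f0_effective.
move=> D D' q q' k qk kuv.
have [||h0 qh hk] := fuF _ _ (sval q) (sval q') (sval k).
- exact: lax_hom_fun qk.
- move=> Z u v uv.
  have H : k ∘ to_lax_pb (p := f) (q := q) u =
      k ∘ to_lax_pb (p := f) (q := q) v.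
    by apply: kuv; apply: lax_hom_eq => ?; apply: Ord_hom_app.
  exact: lax_hom_fun H.
have h0_lax x : lax_map D x ⊑ lax_map D' (h0 x).
  have qx : sval q' (h0 x) = sval q x by exact: (Ord_hom_app (A := lax_ord D) x qh).
  (* Condition (2) at the pair [q x ⊑ q x] writes the value at [x] as a join. Up to the order of the
     meet, its term for [a] is the value of the pullback at [(a, x)], which [k] bounds by the value
     at [h0 x]. *)
  have [le_join _] := covering (ole_refl (sval q x)) (svalP q x).
  apply: ole_trans le_join _; apply: join_in_least.
    by rewrite -qx; exact: (svalP q').
  move=> _ [a [_ [_ ax _ ->]]] _.
  have := svalP k (exist _ (a, x) ax).
  have -> : sval k (exist _ (a, x) ax) = h0 x.
    by rewrite -hk.
  apply: ole_trans; rewrite /= ax; apply: meet_in_greatest.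
  - exact: meet_in_le.
  - by apply: meet_in_ler; exact: lax_map_fibre.
  - by apply: meet_in_lel; exact: (svalP q).
by exists (exist _ h0 h0_lax); apply: lax_hom_eq => ?; apply: Ord_hom_app.
Qed.


Lemma lax_descent_effective : descent_effective (lax_pullbacks hX) f.
Proof.
have [_ _ eF] := (effective_descentP Ord_pullbacks f0).1 f0_effective.
move=> D c act [ca cu cm].
have [|D0 [q [i [ii ic ia]]]] := eF _ (sval c) (sval act).
  split.
  - exact: lax_hom_fun ca.
  - move=> Z t e.
    have H : act ∘ to_lax_pb (p := f) (q := f ∘ c) t =
      pb_snd _ ∘ to_lax_pb (p := f) (q := f ∘ c) t.
      by apply: cu; apply: lax_hom_eq => ?; apply: Ord_hom_app.
    exact: lax_hom_fun H.
  - move=> Z r s t rs ts tr.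
    pose l := @to_lax_pb _ _ _ f (f ∘ c).
    have H : act ∘ l _ r = act ∘ l _ t.
      by apply: (cm _ _ (l _ s)); apply: lax_hom_eq => ?; apply: Ord_hom_app.
    exact: lax_hom_fun H.
have [j ij ji] := Ord_isoP ii.
pose d := lax_map D; pose e x := (sval (i x)).2.
have icE x : (sval (i x)).1 = sval c x.
  exact: (Ord_hom_app (A := lax_ord D) x ic).
have qe x : q (e x) = f0 (sval c x) by rewrite -icE; exact: esym (svalP (i x)).
have dc x : d x ⊑ α (sval c x) by exact: (svalP c).
have dq x : d x ⊑ β (q (e x)).
  by apply: ole_trans (dc x) _; apply: lax_map_fibre; rewrite qe.
(* This is laxness of the action, which sends the pair [(sval c x', x)] to [x'] when both elements
   lie in the same orbit. *)
have act_fibre x x' : e x = e x' ->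
    meet (f0 (sval c x')) (α (sval c x')) (d x) ⊑ d x'.
  move=> ex; have fc : f0 (sval c x') = f0 (sval c x) by rewrite -!qe ex.
  pose t : lax_ord (lax_pb_obj hX f (f ∘ c)) := exist _ (sval c x', x) fc.
  have := svalP act t; rewrite (_ : sval act t = x') //.
  apply: (can_inj ij); apply: ord_pb_ext; rewrite /= ?icE.
    exact: (lax_hom_app (A := lax_pb_obj hX f (f ∘ c)) t ca).
  rewrite -[RHS]/(e x') -ex.
  exact: (Ord_hom_app (A := lax_ord (lax_pb_obj hX f (f ∘ c))) t ia).
pose d0 y := join (q y) [set v | exists x, e x = y /\ v = d x].
have d_le x : d x ⊑ d0 (e x) by apply: join_in_ub; [exists x|exact: dq].
have d_glue x : meet (q (e x)) (α (sval c x)) (d0 (e x)) ⊑ d x.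
  set y := e x.
  (* Several orbits may lie over one point of [B], so [σ] takes its values from the orbit [y] alone.
     Off the fibre over [q y] it is [bot], where compatibility is immediate. *)
  pose σ a := if pselect (f0 a = q y) is left h then d (j (exist _ (a, y) h))
              else bot.
  have σE z : e z = y -> σ (sval c z) = d z.
    move=> ez; rewrite /σ; case: pselect => [h|]; last by rewrite -ez qe.
    congr (lax_map D _); rewrite -[RHS]ij; congr (j _).
    by apply: ord_pb_ext; rewrite /= ?icE // -ez.
  have fibreP a : f0 a = q y -> exists2 z, e z = y & sval c z = a.
    move=> h; exists (j (exist _ (a, y) h)); first by rewrite /e ji.
    by rewrite -icE ji.
  have σN a : f0 a <> q y -> σ a = bot by rewrite /σ; case: pselect.
  have σα a : σ a ⊑ α a.
    case: (pselect (f0 a = q y)) => [/fibreP[z ez <-]|/σN ->] //.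
    by rewrite σE.
  have dqy z : e z = y -> d z ⊑ β (q y) by move=> <-.
  have αq z : e z = y -> α (sval c z) ⊑ β (q y).
    by move=> ez; apply: lax_map_fibre; rewrite -qe ez.
  (* One inequality of the compatibility in (3) comes from [act_fibre]; the other follows by
     swapping the meets. *)
  have half z z' : e z = y -> e z' = y ->
      meet (q y) (d z') (α (sval c z)) ⊑ meet (q y) (α (sval c z')) (d z).
    move=> ez ez'; have [zq zα] := (dqy _ ez', αq _ ez).
    apply: meet_in_greatest; first exact: meet_in_le.
      exact: ole_trans (meet_in_lel hX _ zq) (dc z').
    apply: ole_trans (meet_in_swap hX zq zα) _.
    by rewrite -{1}ez qe; apply: act_fibre; rewrite ez.
  have [|glued _] := @glue σ σα _ _ _ (esym (qe x)).
    move=> b a a' ab a'b; case: (pselect (b = q y)) => [by_|bN]; last first.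
      rewrite !σN ?ab ?a'b //.
      split; apply: ole_trans (bot_le _).
        by apply: meet_in_lel.
      by apply: meet_in_ler.
    have [z ez zc] := fibreP a (etrans ab by_).
    have [z' ez' z'c] := fibreP a' (etrans a'b by_).
    rewrite -zc -z'c !σE // by_; split; first exact: half.
    apply: ole_trans (meet_in_swap hX (αq _ ez') (dqy _ ez)) _.
    apply: ole_trans (half _ _ ez' ez) _.
    exact: meet_in_swap (αq _ ez) (dqy _ ez').
  rewrite σE // in glued; apply: ole_trans glued.
  apply: meet_in_mono;
    [exact: αq|exact: join_in_le|exact: ole_refl|].
  apply: join_in_least; first exact: join_in_le.
  move=> _ [z [ez ->]] zq; apply: join_in_ub => //.
  by exists (sval c z); rewrite σE // -qe ez.
have d0_le y y' : y ⊑ y' -> d0 y ⊑ d0 y'.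
  move=> yy; have qyy := mono_le q yy.
  (* Condition (2) splits [d0 y] into meets with [α a] for [a ⊑ a'] over [q y ⊑ q y']. By [d_glue]
     each meet lies below the value at the element of the orbit [y] over [a], hence below that of
     the orbit [y'] over [a']. *)
  have [le_join _] := covering qyy (join_in_le hX _ _ : d0 y ⊑ _).
  apply: ole_trans le_join _.
  (* The join is least among bounds below [β (q y)], so [d0 y'] is first cut down to that level. *)
  apply: ole_trans (_ : meet (q y') (d0 y') (β (q y)) ⊑ _); last first.
    by apply: meet_in_lel; exact: join_in_le.
  have βqyy : β (q y) ⊑ β (q y') by exact: mono_le.
  apply: join_in_least => [|_ [a [a' [aa ay ay' ->]]] vq].
    by apply: meet_in_ler.
  apply: meet_in_greatest => //; first exact: ole_trans vq _.
  pose x := j (exist _ (a, y) ay); pose x' := j (exist _ (a', y') ay').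
  have xc : sval c x = a by rewrite -icE ji.
  have xe : e x = y by rewrite /e ji.
  have xe' : e x' = y' by rewrite /e ji.
  have xx : d x ⊑ d x' by apply: mono_le; exact: mono_le.
  rewrite -xe' -xe -xc; apply: ole_trans (d_le x'); apply: ole_trans xx.
  apply: ole_trans (d_glue x); apply: meet_in_swap; first exact: join_in_le.
  by apply: lax_map_fibre; rewrite -qe.
pose D' : lax_comma X := LaxObj (MonotoneMap d0_le).
pose q' : D' ~> B := exist _ q (fun y => join_in_le hX _ _).
have i_lax x : d x ⊑ lax_map (lax_pb_obj hX f q') (i x).
  rewrite /= icE -qe; apply: meet_in_greatest; [exact: dq|exact: dc|exact: d_le].
pose i' : D ~> pb_obj (lax_pullbacks hX f q') := exist _ i i_lax.
have j_lax t : lax_map (lax_pb_obj hX f q') t ⊑ d (j t).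
  apply: ole_trans (d_glue (j t)); rewrite -icE /= /e ji.
  by have /= <- := svalP t; exact: ole_refl.
pose j' : pb_obj (lax_pullbacks hX f q') ~> D := exist _ j j_lax.
exists D', q', i'; split.
- by exists j'; split; apply: lax_hom_eq => x; [exact: ij|exact: ji].
- by apply: lax_hom_eq => x; exact: icE.
- apply: lax_hom_eq => t.
  exact: (Ord_hom_app (A := lax_ord (lax_pb_obj hX f (f ∘ c))) t ia).
Qed.

Lemma lax_effective_descent : effective_descent (lax_pullbacks hX) f.
Proof.
apply/effective_descentP; split; [exact: lax_descent_faithful
  |exact: lax_descent_full|exact: lax_descent_effective].
Qed.

End Sufficiency.
End Bottom.
End LaxDescent.

(** * Necessity *)

Section Necessity.
Variables (X : ordset) (hX : locally_complete X) (bot : X).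
Hypothesis bot_le : forall x, bot ⊑ x.
Variables (A B : lax_comma X) (f : A ~> B).

Local Notation α := (lax_map A).
Local Notation β := (lax_map B).
Local Notation f0 := (sval f : (lax_ord A : Ord) ~> (lax_ord B : Ord)).
Local Notation meet b := (meet_in hX (β b)).
Local Notation join b := (join_in hX (β b)).

Hypothesis f_effective : effective_descent (lax_pullbacks hX) f.

Let from_bot (Z : ordset) (D : lax_comma X) (u : monotone_map Z (lax_ord D)) :
  lax_bot bot Z ~> D := exist _ u (fun=> bot_le _).

Definition codiscrete_bool : ordset :=
  @OrdSet bool (fun _ _ => True) (fun _ => I) (fun _ _ _ _ _ => I).

Definition discrete_bool : ordset :=
  @OrdSet bool eq (@erefl bool) (fun _ _ _ => @etrans _ _ _ _).

Lemma implyb_trans (y x z : bool) : (x -> y) -> (y -> z) -> x -> z.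
Proof. by case: x y z => [] [] []. Qed.

Definition arrow_bool : ordset :=
  @OrdSet bool (fun x y => x -> y) (fun _ => id) implyb_trans.

(** Over a point outside the image the pullback is empty, and faithfulness would identify two
    distinct maps into [codiscrete_bool]. *)
Lemma effective_lifts_points (b : lax_ord B) : exists a, f0 a = b.
Proof.
have [faF _ _] := (effective_descentP (lax_pullbacks hX) f).1 f_effective.
apply: contrapT => /forallNP no_a.
pose q := from_bot (const_map point b).
pose q' := from_bot (const_map codiscrete_bool b).
pose h (x : codiscrete_bool) : lax_bot bot point ~> lax_bot bot codiscrete_bool :=
  from_bot (D := lax_bot bot codiscrete_bool) (const_map point x).
have : h true = h false.
  apply: (faF _ _ q q'); apply: lax_hom_eq => // -[[a x] e].
  by case: (no_a a).
by move/(lax_hom_app (A := lax_bot bot point) tt).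
Qed.

(** Without a lifted pair, the two ends of the pulled-back arrow are incomparable, so its projection
    to [discrete_bool] is monotone. Fullness would then make the identity monotone from [arrow_bool]
    to [discrete_bool]. *)
Lemma effective_lifts_pairs (b0 b1 : lax_ord B) : b0 ⊑ b1 ->
  exists a0 a1 : lax_ord A, [/\ a0 ⊑ a1, f0 a0 = b0 & f0 a1 = b1].
Proof.
have [_ fuF _] := (effective_descentP (lax_pullbacks hX) f).1 f_effective.
move=> b01; apply: contrapT => no_pair.
pose b x := if x then b1 else b0.
have b_arrow (x y : arrow_bool) : x ⊑ y -> b x ⊑ b y.
  by case: x y => [] [] //= xy; [exact: ole_refl|have := xy isT|exact: ole_refl].
have b_discrete (x y : discrete_bool) : x ⊑ y -> b x ⊑ b y.
  by move=> /= ->; exact: ole_refl.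
pose q := from_bot (D := B) (MonotoneMap b_arrow).
pose q' := from_bot (D := B) (MonotoneMap b_discrete).
have k_le (s t : lax_ord (lax_pb_obj hX f q)) : s ⊑ t ->
    (sval s).2 = (sval t).2 :> bool.
  case: s t => [[a x] /= ax] [[a' x'] /= ax'] [/= aa xx].
  case: x x' ax ax' xx => [] [] //= ax ax' xx; first by have := xx isT.
  by case: no_pair; exists a, a'.
have k_lax (t : lax_ord (lax_pb_obj hX f q)) :
    lax_map (lax_pb_obj hX f q) t ⊑ bot.
  by apply: meet_in_ler; exact: bot_le.
pose k : pb_obj (lax_pullbacks hX f q) ~> lax_bot bot discrete_bool :=
  exist _ (@MonotoneMap (lax_ord (lax_pb_obj hX f q)) discrete_bool _ k_le) k_lax.
have [||h _ hk] := fuF _ _ q q' k.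
- by apply: lax_hom_eq => -[[a x] e].
- move=> Z u v uv; apply: lax_hom_eq => z.
  exact: lax_hom_app z uv.
have hE (x : arrow_bool) : sval h x = x.
  have [a ax] := effective_lifts_points (b x).
  exact: (lax_hom_app (A := lax_pb_obj hX f q) (exist _ (a, x) ax) hk).
have : sval h false = sval h true by exact: (mono_le (sval h) (x := false) (y := true)).
by rewrite !hE.
Qed.

(** One point over [b] carries either [w] or the join. After pulling back, the first value lies
    below the second, and fullness descends this inequality. *)
Lemma effective_covers_points (b : lax_ord B) (w : X) : w ⊑ β b ->
  w ⊑ join b [set v | exists2 a, f0 a = b & v = meet b w (α a)].
Proof.
have [_ fuF _] := (effective_descentP (lax_pullbacks hX) f).1 f_effective.
set j := join b _ => wb; have jb : j ⊑ β b := join_in_le hX _ _.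
pose D (v : X) : lax_comma X := LaxObj (const_map point v).
pose q v (vb : v ⊑ β b) : D v ~> B :=
  exist (fun u : monotone_map point (lax_ord B) =>
    forall x, lax_map (D v) x ⊑ β (u x)) (const_map point b) (fun=> vb).
have k_lax (t : lax_ord (lax_pb_obj hX f (q _ wb))) :
    lax_map (lax_pb_obj hX f (q _ wb)) t ⊑ j.
  case: t => [[a x] /= ab]; apply: ole_trans (_ : meet b w (α a) ⊑ j).
    by rewrite ab; exact: meet_in_swap (lax_map_fibre ab) wb.
  by apply: join_in_ub; [exists a|exact: meet_in_le].
pose k : pb_obj (lax_pullbacks hX f (q _ wb)) ~> D j :=
  exist _ (const_map (lax_ord (lax_pb_obj hX f (q _ wb))) (tt : point)) k_lax.
have [||h _ _] := fuF _ _ (q _ wb) (q _ jb) k.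
- by apply: lax_hom_eq => -[[a x] e].
- by move=> Z u v uv; apply: lax_hom_eq.
exact: (svalP h tt).
Qed.

(* [I] indexes points of the base [B], [r] a relation between them that is
   transitive only along chains lifted to [A], and [c] the [X]-values of the
   pulled-back points; the conclusion says that the family descends to a
   genuine ordered family [D] over [B]. *)
Lemma effective_family (I : Type) (b : I -> lax_ord B) (r : I -> I -> Prop)
    (c : lax_ord A -> I -> X) :
  (forall i, r i i) ->
  (forall i j k a0 a1 a2, a0 ⊑ a1 -> a1 ⊑ a2 -> f0 a0 = b i -> f0 a1 = b j ->
    f0 a2 = b k -> r i j -> r j k -> r i k) ->
  (forall i a, f0 a = b i -> c a i ⊑ α a) ->
  (forall i j a a', f0 a = b i -> f0 a' = b j -> a ⊑ a' -> r i j ->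
    c a i ⊑ c a' j) ->
  (forall i a a', f0 a = b i -> f0 a' = b i ->
    meet (b i) (α a) (c a' i) ⊑ c a i) ->
  exists (D : lax_comma X) (q : D ~> B) (h : I -> lax_ord D),
    [/\ forall i, sval q (h i) = b i,
       forall i j a a', f0 a = b i -> f0 a' = b j -> a ⊑ a' ->
         (h i ⊑ h j <-> r i j)
     & forall i a, f0 a = b i -> c a i ≅ meet (b i) (α a) (lax_map D (h i))].
Proof.
have [_ _ eF] := (effective_descentP (lax_pullbacks hX) f).1 f_effective.
move=> rr rt cα cr cact.
pose T := {t : lax_ord A * I | f0 t.1 = b t.2}.
pose T_le (s t : T) := (sval s).1 ⊑ (sval t).1 /\ r (sval s).2 (sval t).2.
have T_refl t : T_le t t by split; [exact: ole_refl|exact: rr].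
have T_trans t s u : T_le s t -> T_le t u -> T_le s u.
  move=> [st1 st2] [tu1 tu2]; split; first exact: ole_trans st1 tu1.
  exact: (rt _ _ _ _ _ _ st1 tu1 (svalP s) (svalP t) (svalP u)).
pose CT := OrdSet T_refl T_trans.
have C_le (s t : CT) : s ⊑ t -> c (sval s).1 (sval s).2 ⊑ c (sval t).1 (sval t).2.
  by move=> [st1 st2]; apply: cr => //; [exact: svalP s|exact: svalP t].
pose C : lax_comma X := LaxObj (MonotoneMap C_le).
have fst_le (s t : CT) : s ⊑ t -> (sval s).1 ⊑ (sval t).1 by case.
have c_lax (t : CT) : lax_map C t ⊑ α (sval t).1 by exact: cα (svalP t).
pose γ : C ~> A := exist _ (MonotoneMap fst_le) c_lax.
have act_sub (t : lax_ord (lax_pb_obj hX f (f ∘ γ))) :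
    f0 (sval t).1 = b (sval (sval t).2).2.
  by rewrite (svalP t); exact: (svalP (sval t).2).
pose act0 (t : lax_ord (lax_pb_obj hX f (f ∘ γ))) : CT :=
  exist _ ((sval t).1, (sval (sval t).2).2) (act_sub t).
have act_le s t : s ⊑ t -> act0 s ⊑ act0 t by case=> s1 [s2 s3].
have act_lax t : lax_map (lax_pb_obj hX f (f ∘ γ)) t ⊑ lax_map C (act0 t).
  by rewrite /= act_sub; apply: cact; [exact: act_sub|exact: (svalP (sval t).2)].
pose act : pb_obj (lax_pullbacks hX f (f ∘ γ)) ~> C :=
  exist _ (MonotoneMap act_le) act_lax.
have T_ext (s t : CT) : (sval s).1 = (sval t).1 -> (sval s).2 = (sval t).2 -> s = t.
  case: s t => [[a i] e] [[a' i'] e'] /= aa ii.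
  by apply: eq_exist; rewrite aa ii.
have [|D [q [m [[n [nm mn]] mc ma]]]] := eF C γ act.
  split; first exact: lax_hom_eq.
    move=> Z t tE; apply: lax_hom_eq => z; apply: T_ext => //=.
    exact: lax_hom_app z tE.
  move=> Z s t u st us ut; apply: lax_hom_eq => z; apply: T_ext => /=.
    exact: esym (lax_hom_app z ut).
  have /= -> := congr1 (fun v : CT => (sval v).2) (lax_hom_app z st).
  by have /= -> := congr1 (fun v : CT => (sval v).2) (lax_hom_app z us).
pose s i := sval (cid (effective_lifts_points (b i))).
have sE i : f0 (s i) = b i := svalP (cid (effective_lifts_points (b i))).
pose el a i (e : f0 a = b i) : CT := exist _ (a, i) e.
pose h i := (sval (sval m (el _ _ (sE i)))).2.
have m1 t : (sval (sval m t)).1 = (sval t).1 by exact: (lax_hom_app (A := C) t mc).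
have m2 a i (e : f0 a = b i) : (sval (sval m (el _ _ e))).2 = h i.
  (* The pair [(a, i)] results from [a] acting on the chosen [(s i, i)], and the second component of
     [m] is invariant under the action. *)
  have e' : f0 a = f0 (s i) by rewrite e sE.
  pose t : lax_ord (lax_pb_obj hX f (f ∘ γ)) := exist _ (a, el _ _ (sE i)) e'.
  rewrite (_ : el _ _ e = act0 t); last exact: T_ext.
  exact: (lax_hom_app (A := lax_pb_obj hX f (f ∘ γ)) t ma).
have qh i : sval q (h i) = b i.
  have := svalP (sval m (el _ _ (sE i))); rewrite m1 /= => <-.
  exact: sE.
have nK t : sval n (sval m t) = t by exact: (lax_hom_app (A := C) t nm).
exists D, q, h; split=> //.
  move=> i j a a' e e' aa; split=> [hij|rij].
    have mm : sval m (el _ _ e) ⊑ sval m (el _ _ e').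
      by split; rewrite ?m1 ?m2.
    by have := mono_le (sval n) mm; rewrite !nK => -[].
  have mm : el _ _ e ⊑ el _ _ e' by [].
  by have [_] := mono_le (sval m) mm; rewrite !m2.
move=> i a e.
have := svalP m (el _ _ e); have := svalP n (sval m (el _ _ e)).
by rewrite nK /= m1 m2 /= e.
Qed.

(** If no chain lifted, the relation linking 0 to 1 and 1 to 2 but not 0 to 2 would be admissible in
    [effective_family]. The descended order is transitive, and a lift of the pair [b0 ⊑ b2] reads
    off the missing link. *)
Lemma effective_lifts_chains : lifts_chains f0.
Proof.
move=> b0 b1 b2 b01 b12; apply: contrapT => no_chain.
(* The default of [nth] places every index from 2 on at [b2]; the bound in [r] leaves the indices
   above 2 related only to themselves. *)
pose b := nth b2 [:: b0; b1].
pose r i j := i = j \/ j = i.+1 /\ j <= 2.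
have [|||||D [q [h [qh hr _]]]] := @effective_family nat b r (fun _ _ => bot).
- by move=> i; left.
- move=> i j k a0 a1 a2 a01 a12 e0 e1 e2.
  case=> [-> //|[ij j2]] [<-|[jk k2]]; first by right.
  (* Two proper steps ending at most at 2 must start at 0. *)
  case: no_chain; exists a0, a1, a2; move: e0 e1 e2; rewrite jk ij in k2 *.
  by case: i {ij jk} k2.
- by [].
- by move=> *; exact: ole_refl.
- by move=> *; apply: meet_in_ler; exact: bot_le.
have h_le i j a a' : a ⊑ a' -> f0 a = b i -> f0 a' = b j -> r i j -> h i ⊑ h j.
  by move=> aa e e'; exact: (hr _ _ _ _ e e' aa).2.
have [a0 [a1 [a01 e0 e1]]] := effective_lifts_pairs b01.
have [a1' [a2 [a12 e1' e2]]] := effective_lifts_pairs b12.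
have [a [a' [aa e e']]] := effective_lifts_pairs (ole_trans b01 b12).
have h02 : h 0 ⊑ h 2.
  apply: (@ole_trans _ (h 1)).
    by apply: (h_le 0 1 a0 a1) => //; right.
  by apply: (h_le 1 2 a1' a2) => //; right.
by case: ((hr 0 2 _ _ e e' aa).1 h02) => // -[].
Qed.

(** With [w] over [b0] and the join [j] over [b1], the pulled-back values increase along every
    lifted pair. Comparing [w] and [j] with the descended values through [effective_covers_points]
    gives [w ⊑ j]. *)
Lemma effective_pair_covering : pair_covering hX f.
Proof.
move=> b0 b1 b01 w wb; set S := [set v | _]; set j := join b0 S.
have jw : j ⊑ w.
  by apply: join_in_least => // _ [a0 [a1 [_ _ _ ->]]] _; exact: meet_in_lel.
split=> //.
have jb : j ⊑ β b1 by apply: ole_trans (join_in_le hX _ _) _; exact: mono_le.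
pose b x := if x then b1 else b0; pose v x := if x then j else w.
have vb x : v x ⊑ β (b x) by case: x.
have [|||||D [q [h [qh hr hc]]]] :=
  @effective_family bool b (fun x y => x -> y) (fun a x => meet (b x) (α a) (v x)).
- by move=> x.
- by move=> x y z a0 a1 a2 _ _ _ _ _ xy yz /xy.
- by move=> x a ax; apply: meet_in_lel; exact: lax_map_fibre ax.
- move=> x y a a' ax ay aa xy.
  have αx := lax_map_fibre ax; have αy := lax_map_fibre ay.
  have vx := vb x; have vy := vb y.
  have bb : β (b x) ⊑ β (b y) by rewrite -ax -ay; do 2!apply: mono_le.
  apply: meet_in_greatest.
  + exact: ole_trans (meet_in_le _ _ _ _) bb.
  + by apply: ole_trans (meet_in_lel hX _ αx) _; exact: mono_le.
  + case: x y ax ay xy {αx αy bb} vx vy => [] [] //= ax ay xy vx vy.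
    * exact: meet_in_ler.
    * by have := xy isT.
    (* The crossing from [b0] to [b1]: the meet is one of the terms of the join [j]. *)
    * apply: ole_trans (meet_in_swap hX (lax_map_fibre ax) vx) _.
      by apply: join_in_ub; [exists a, a'|exact: meet_in_le].
    * exact: meet_in_ler.
- move=> x a a' ax ax'; apply: meet_in_greatest; first exact: meet_in_le.
    by apply: meet_in_lel; exact: lax_map_fibre ax.
  apply: ole_trans (meet_in_ler hX _ (meet_in_le _ _ _ _)) _.
  exact: meet_in_ler.
have [a [a' [aa e e']]] := effective_lifts_pairs b01.
have h01 : h false ⊑ h true by exact: (hr false true _ _ e e' aa).2.
have dE x : lax_map D (h x) ⊑ β (b x) by rewrite -(qh x); exact: (svalP q).
have hv x a1 : f0 a1 = b x -> meet (b x) (lax_map D (h x)) (α a1) ⊑ v x.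
  move=> e1; have [_ le_c] := hc x a1 e1.
  apply: ole_trans (meet_in_swap hX (dE x) (lax_map_fibre e1)) _.
  by apply: ole_trans le_c _; exact: meet_in_ler.
have vh x a1 : f0 a1 = b x -> meet (b x) (v x) (α a1) ⊑ lax_map D (h x).
  move=> e1; have [c_le _] := hc x a1 e1.
  apply: ole_trans (meet_in_swap hX (vb x) (lax_map_fibre e1)) _.
  by apply: ole_trans c_le _; exact: meet_in_ler.
apply: ole_trans (_ : lax_map D (h false) ⊑ _).
  apply: ole_trans (effective_covers_points wb) _.
  apply: join_in_least => [|_ [a1 e1 ->] _]; first exact: (dE false).
  exact: (vh false).
apply: ole_trans (mono_le (lax_map D) h01) _.
apply: ole_trans (effective_covers_points (dE true)) _.
apply: join_in_least => [|_ [a1 e1 ->] _] //.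
exact: (hv true).
Qed.

(** The family descends to a single value [d] over [b] with [σ a ≅ α a ∧ d] throughout the fibre.
    The join of the [σ a] is then below [d], so its meet with [α a'] is below [σ a']. *)
Lemma effective_families_glue : families_glue hX f.
Proof.
move=> σ σα σc b a' a'b.
have σb a : f0 a = b -> σ a ⊑ β b.
  by move=> ab; exact: ole_trans (σα a) (lax_map_fibre ab).
have [|||||D [q [h [qh _ hc]]]] :=
  @effective_family unit (fun=> b) (fun _ _ => True) (fun a _ => σ a).
- by [].
- by [].
- by move=> _ a _; exact: σα.
(* Compatibility makes [σ] monotone on the fibre: [σ a1] is below [α a1], hence below [α a2], so it
   lies below [σ a1 ∧ α a2 ≅ α a1 ∧ σ a2]. *)
- move=> _ _ a1 a2 e1 e2 a12 _.
  have αb := lax_map_fibre e2.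
  have [c_le _] := σc _ _ _ e2 e1.
  apply: ole_trans (meet_in_ler hX _ (σb _ e2)).
  apply: ole_trans c_le; apply: meet_in_greatest; first exact: σb.
    exact: ole_refl.
  by apply: ole_trans (σα a1) _; exact: mono_le.
- move=> _ a1 a2 e1 e2; have [c_le _] := σc _ _ _ e1 e2.
  apply: ole_trans (meet_in_swap hX (lax_map_fibre e1) (σb _ e2)) _.
  by apply: ole_trans c_le _; apply: meet_in_ler; exact: σb.
have αb := lax_map_fibre a'b.
have db : lax_map D (h tt) ⊑ β b by rewrite -(qh tt); exact: (svalP q).
split; last first.
  apply: meet_in_greatest => //; first exact: σb.
  by apply: join_in_ub; [exists a'|exact: σb].
apply: ole_trans (hc tt a' a'b).2; apply: meet_in_mono => //.
- exact: join_in_le.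
- exact: ole_refl.
apply: join_in_least => // _ [a [ab ->]] _.
by apply: ole_trans (hc tt a ab).1 _; exact: meet_in_ler.
Qed.

End Necessity.

(** Over the one-point ordered set (2) and (3) hold trivially, so effectiveness in [Ord] passes to
    the lax comma category by sufficiency, where [effective_lifts_chains] applies. *)
Lemma Ord_effective_lifts_chains (A B : Ord) (f : A ~> B) :
  effective_descent Ord_pullbacks f -> lifts_chains f.
Proof.
move=> f_eff.
have hX : locally_complete point by move=> x S; exists (exist _ tt I).
pose top (D : ordset) : lax_comma point := LaxObj (const_map D (tt : point)).
pose g : top A ~> top B := exist _ f (fun=> I).
apply: (@effective_lifts_chains point hX tt (fun=> I) _ _ g).
exact: (@lax_effective_descent point hX _ _ g tt (fun=> I)).
Qed.

Lemma Ord_effective_descentP (A B : Ord) (f : A ~> B) :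
  effective_descent Ord_pullbacks f <-> lifts_chains f.
Proof.
split; first exact: Ord_effective_lifts_chains.
exact: chains_effective_descent.
Qed.

Theorem theorem3p1 (X : ordset) (hX : locally_complete X) (hbot : has_bottom X)
    (A B : lax_comma X) (f : A ~> B) :
  let α := lax_map A in
  let β := lax_map B in
  let f0 : (lax_ord A : Ord) ~> (lax_ord B : Ord) := sval f in
  (effective_descent Ord_pullbacks f0 <->
     (forall b0 b1 b2 : lax_ord B, b0 ⊑ b1 -> b1 ⊑ b2 ->
        exists a0 a1 a2 : lax_ord A,
          [/\ a0 ⊑ a1, a1 ⊑ a2, f0 a0 = b0, f0 a1 = b1 & f0 a2 = b2]))
  /\
  (effective_descent (lax_pullbacks hX) f <->
     [/\ effective_descent Ord_pullbacks f0,
         (forall b0 b1 : lax_ord B, b0 ⊑ b1 -> forall w : X, w ⊑ β b0 ->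
            w ≅ join_in hX (β b0)
                  [set v | exists a0 a1 : lax_ord A,
                     [/\ a0 ⊑ a1, f0 a0 = b0, f0 a1 = b1 &
                         v = meet_in hX (β b0) w (α a0)]])
       & (forall σ : lax_ord A -> X,
            (forall a, σ a ⊑ α a) ->
            (forall (b : lax_ord B) (a a' : lax_ord A), f0 a = b -> f0 a' = b ->
               meet_in hX (β b) (σ a') (α a) ≅ meet_in hX (β b) (α a') (σ a)) ->
            forall (b : lax_ord B) (a' : lax_ord A), f0 a' = b ->
              meet_in hX (β b) (α a')
                (join_in hX (β b) [set v | exists a, f0 a = b /\ v = σ a])
              ≅ σ a')]).
Proof.
have [bot bot_le] := hbot; move=> α β f0; split.
  exact: Ord_effective_descentP.
split=> [f_eff|[f0_eff covering glue]].
  split; [apply/Ord_effective_descentP; exact: effective_lifts_chains f_eff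
    |exact: effective_pair_covering f_eff|exact: effective_families_glue f_eff].
exact: (@lax_effective_descent X hX A B f bot bot_le).
Qed.
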